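(* Let $\lambda,\mu,R,C>0$ with $\rho:=\lambda/\mu<1$ and $\mu R>C$, and let $\tau^*$ be a maximizer of the gated-admission welfare $u(\pi_\tau)$ over $\tau\ge0$. Define, for $\sigma\in(0,\rho]$, $$\tau(\sigma)=\frac{1}{\mu(1-\sigma)}\log\!\left(\frac{\lambda}{\sigma(\lambda+\mu(1-\sigma))}\right),\qquad \zeta(\sigma)=\lambda\log\!\left(\frac{\lambda}{\sigma(\lambda+\mu(1-\sigma))}\right)+\mu(1-\sigma).$$ Then $$\tau^*=0\iff \frac{\mu R}{C}\ge\frac{2-\rho}{(1-\rho)^2}.$$ If instead $\frac{\mu R}{C}<\frac{2-\rho}{(1-\rho)^2}$, then $\tau^*=\tau(\sigma^* )$, where $\sigma^*$ is the unique solution in $(0,\rho)$ of $$\mu R\,\zeta(\sigma)=-\bigl(\mu(1-\sigma)R-C\bigr)\,\zeta'(\sigma),\qquad \zeta'(\sigma)=-\mu-\frac{\lambda(\lambda+\mu-2\mu\sigma)}{\sigma(\lambda+\mu(1-\sigma))},$$ and the optimal welfare is $u(\pi_{\tau^*})=\dfrac{\lambda\bigl(\mu(1-\sigma^* )R-C\bigr)}{\zeta(\sigma^* )}$.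
   Context: Potential customers arrive at a single-server queue in a Poisson process of rate $\lambda$; service times are i.i.d. exponential with rate $\mu$. Each served customer yields reward $R$, and each customer costs $C$ per unit time spent in the system. Gated admission policy $\pi_\tau$: after each admission, arrivals are blocked for $\tau\ge 0$ time units, which gives a GI/M/1 queue with inter-arrival times distributed as $\tau+\mathrm{Exp}(\lambda)$. Its stationary expected social welfare per unit time is $$u(\pi_\tau)=\frac{\lambda}{1+\lambda\tau}\left(R-\frac{C}{\mu(1-\sigma(\tau))}\right),$$ where $\sigma(\tau)\in(0,1)$ is the smallest positive solution of $\sigma=\frac{\lambda e^{-\mu(1-\sigma)\tau}}{\lambda+\mu(1-\sigma)}$ (so $\sigma(0)=\rho$). *)

(* Defs.v *)
From Stdlib Require Import Reals ClassicalEpsilon.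
From Coquelicot Require Import Coquelicot.
Open Scope R_scope.

(* Root equation of the GI/M/1 queue: the right-hand side is the Laplace
   transform of the inter-arrival law tau + Exp(lambda) at mu * (1 - s).
   The denominator vanishes only at s = 1 + lambda / mu > 1, which does not
   affect the smallest positive solution when that one lies in (0, 1). *)
Definition sigma_equation (lambda mu tau s : R) : Prop :=
  s = lambda * exp (- mu * (1 - s) * tau) / (lambda + mu * (1 - s)).

Definition smallest_positive_solution (lambda mu tau s : R) : Prop :=
  0 < s /\ sigma_equation lambda mu tau s /\
  forall s', 0 < s' -> sigma_equation lambda mu tau s' -> s <= s'.

(* A smallest positive solution is unique.  When lambda, mu > 0, tau >= 0 and
   lambda / mu < 1 it also exists and lies in (0, 1), so the choice operator
   then returns exactly this number; elsewhere the value is irrelevant. *)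
Definition sigma (lambda mu tau : R) : R :=
  epsilon (inhabits 0) (smallest_positive_solution lambda mu tau).

(* Stationary expected social welfare per unit time of gated admission with
   gate length tau: throughput times (reward minus expected sojourn cost). *)
Definition welfare (lambda mu reward cost tau : R) : R :=
  lambda / (1 + lambda * tau) *
  (reward - cost / (mu * (1 - sigma lambda mu tau))).

Definition is_maximizer_nonneg (f : R -> R) (t : R) : Prop :=
  0 <= t /\ forall t', 0 <= t' -> f t' <= f t.

Definition tau_of_sigma (lambda mu s : R) : R :=
  1 / (mu * (1 - s)) * ln (lambda / (s * (lambda + mu * (1 - s)))).

Definition zeta (lambda mu s : R) : R :=
  lambda * ln (lambda / (s * (lambda + mu * (1 - s)))) + mu * (1 - s).

(* Main.v *)
(** Parametrise [tau] by the root [s = sigma(tau)], which runs over [(0, rho]].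
    The function [L(s) = ln (lambda / (s (lambda + mu (1 - s))))] is strictly
    convex with [L(1) = 0], so [tau(s)], which is [- 1 / mu] times the slope of
    the chord of [L] from [s] to [1], is strictly decreasing: each [s] is the
    smallest root for [tau(s)].  In this parameter the welfare is
    [lambda N / zeta] with [N(s) = mu (1 - s) R - C] affine and [zeta] positive,
    decreasing and strictly convex.  Its derivative has the sign of
    [G = - mu R zeta - N zeta'], and convexity shows that [G(s2) >= 0] forces
    [G > 0] to the left of [s2].  Hence the maximizer is the end point [rho] when
    [G(rho) >= 0], and the only zero of [G] otherwise. *)
Require Import Defs.
From Stdlib Require Import Reals ClassicalEpsilon Lra.
From Coquelicot Require Import Coquelicot.
Open Scope R_scope.

(** * Logarithm bounds and a directional first-order test *)

Lemma ln_lt_sub_1 (x : R) : 0 < x -> x <> 1 -> ln x < x - 1.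
Proof.
intros x0 x1.
assert (lx : ln x <> 0).
{ intros e; apply x1; rewrite <- (exp_ln x x0), e; apply exp_0. }
pose proof (exp_ineq1 _ lx) as H; rewrite (exp_ln x x0) in H; lra.
Qed.

Lemma ln_le_sub_1 (x : R) : 0 < x -> ln x <= x - 1.
Proof.
intros x0; destruct (Req_dec x 1) as [-> | x1].
- rewrite ln_1; lra.
- left; now apply ln_lt_sub_1.
Qed.

(** Along the segment the derivative at 0 is [d * h], so small positive [t] increase [f]. The bound
    [t < 1] stops short of [x + h], which makes the test usable at the end point [rho]. *)
Lemma is_derive_pos_direction (f : R -> R) (x d h : R) :
  is_derive f x d -> 0 < d * h -> exists t, 0 < t < 1 /\ f x < f (x + t * h).
Proof.
intros df dh.
assert (D : is_derive (fun t => f (x + t * h)) 0 (d * h)).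
{ replace (d * h) with (scal h d) by (unfold scal; simpl; unfold mult; simpl; ring).
  apply (is_derive_comp f (fun t => x + t * h)).
  - now rewrite Rmult_0_l, Rplus_0_r.
  - auto_derive; [exact I | ring]. }
apply is_derive_Reals in D.
destruct (D _ dh) as [[del del0] H]; simpl in H.
set (t := Rmin (del / 2) (1 / 2)).
assert (t0 : 0 < t) by (apply Rmin_glb_lt; lra).
assert (t1 : t <= 1 / 2) by apply Rmin_r.
assert (t2 : t <= del / 2) by apply Rmin_l.
exists t; split; [lra |].
assert (Ht := H t (Rgt_not_eq _ _ t0)).
rewrite Rabs_pos_eq in Ht by lra.
specialize (Ht ltac:(lra)); apply Rabs_def2 in Ht.
rewrite Rplus_0_l, Rmult_0_l, Rplus_0_r in Ht.
assert (q : 0 < (f (x + t * h) - f x) / t) by lra.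
apply (Rmult_lt_compat_r t) in q; [| exact t0].
unfold Rdiv in q; rewrite Rmult_assoc, Rinv_l, Rmult_1_r in q; lra.
Qed.

(** * Strict convexity of the logarithm [L] *)

Definition log_ratio (lambda mu s : R) : R :=
  ln (lambda / (s * (lambda + mu * (1 - s)))).

Definition log_ratio_deriv (lambda mu s : R) : R :=
  - / s + mu / (lambda + mu * (1 - s)).

Lemma service_rate_pos (lambda mu s : R) :
  0 < lambda -> 0 < mu -> s <= 1 -> 0 < lambda + mu * (1 - s).
Proof. intros; assert (0 <= mu * (1 - s)) by (apply Rmult_le_pos; lra); lra. Qed.

Lemma log_ratio_split (lambda mu s : R) :
  0 < lambda -> 0 < mu -> 0 < s <= 1 ->
  log_ratio lambda mu s = ln lambda - ln s - ln (lambda + mu * (1 - s)).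
Proof.
intros l0 m0 [s0 s1]; pose proof (service_rate_pos lambda mu s l0 m0 s1).
unfold log_ratio; rewrite ln_div, ln_mult; try lra.
now apply Rmult_lt_0_compat.
Qed.

Lemma log_ratio_1 (lambda mu : R) : 0 < lambda -> log_ratio lambda mu 1 = 0.
Proof.
intros l0; unfold log_ratio.
replace (lambda / _) with 1 by (field; lra); apply ln_1.
Qed.

(** Up to a constant, [L] is a sum of two terms [- ln] of affine functions. The bound
    [ln u <= u - 1] at [u = x / s] and at the ratio of the other factors puts each term above its
    tangent; the first is strict since [x <> s]. *)
Lemma log_ratio_above_tangent (lambda mu s x : R) :
  0 < lambda -> 0 < mu -> 0 < s <= 1 -> 0 < x <= 1 -> x <> s ->
  log_ratio lambda mu s + log_ratio_deriv lambda mu s * (x - s)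
  < log_ratio lambda mu x.
Proof.
intros l0 m0 hs hx ne.
pose proof (service_rate_pos lambda mu s l0 m0 (proj2 hs)) as as0.
pose proof (service_rate_pos lambda mu x l0 m0 (proj2 hx)) as ax0.
rewrite !log_ratio_split by assumption; unfold log_ratio_deriv.
set (a := lambda + mu * (1 - s)) in *; set (b := lambda + mu * (1 - x)) in *.
assert (H1 : ln (x / s) < x / s - 1).
{ apply ln_lt_sub_1; [apply Rdiv_lt_0_compat; lra |].
  intros e; apply ne; rewrite <- (Rmult_1_l s), <- e; field; lra. }
assert (H2 : ln (b / a) <= b / a - 1)
  by (apply ln_le_sub_1; apply Rdiv_lt_0_compat; lra).
rewrite ln_div in H1 by lra; rewrite ln_div in H2 by lra.
replace ((- / s + mu / a) * (x - s)) with (- (x / s - 1) - (b / a - 1)).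
- lra.
- unfold b; replace (lambda + mu * (1 - x)) with (a - mu * (x - s))
    by (unfold a; ring); field; lra.
Qed.

(** * Monotonicity of [tau(s)] and inversion of the root equation *)

Lemma tau_of_sigma_log_ratio (lambda mu s : R) :
  tau_of_sigma lambda mu s = log_ratio lambda mu s / (mu * (1 - s)).
Proof. unfold tau_of_sigma, log_ratio, Rdiv; ring. Qed.

Lemma tau_of_sigma_decreasing (lambda mu s1 s2 : R) :
  0 < lambda -> 0 < mu -> 0 < s1 -> s1 < s2 -> s2 < 1 ->
  tau_of_sigma lambda mu s2 < tau_of_sigma lambda mu s1.
Proof.
intros l0 m0 h1 h12 h2; rewrite !tau_of_sigma_log_ratio.
pose proof (log_ratio_above_tangent lambda mu s2 1 l0 m0
  ltac:(lra) ltac:(lra) ltac:(lra)) as T1.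
pose proof (log_ratio_above_tangent lambda mu s2 s1 l0 m0
  ltac:(lra) ltac:(lra) ltac:(lra)) as T2.
rewrite log_ratio_1 in T1 by assumption.
set (A := log_ratio lambda mu s2) in *; set (B := log_ratio lambda mu s1) in *.
set (D := log_ratio_deriv lambda mu s2) in *.
(* With these weights the tangent slope [D] cancels in the sum, leaving the comparison of chord
   slopes. *)
assert (P1 := Rmult_lt_compat_r (s2 - s1) _ _ ltac:(lra) T1).
assert (P2 := Rmult_lt_compat_r (1 - s2) _ _ ltac:(lra) T2).
assert (P : A * (1 - s1) < B * (1 - s2)) by lra.
assert (0 < mu * (1 - s1)) by (apply Rmult_lt_0_compat; lra).
assert (0 < mu * (1 - s2)) by (apply Rmult_lt_0_compat; lra).
apply (Rmult_lt_reg_r ((mu * (1 - s1)) * (1 - s2))).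
{ apply Rmult_lt_0_compat; lra. }
replace (A / (mu * (1 - s2)) * _) with (A * (1 - s1)) by (field; lra).
replace (B / (mu * (1 - s1)) * _) with (B * (1 - s2)) by (field; lra).
exact P.
Qed.

Lemma sigma_equation_iff (lambda mu t s : R) :
  0 < lambda -> 0 < mu -> 0 < s < 1 ->
  sigma_equation lambda mu t s <-> t = tau_of_sigma lambda mu s.
Proof.
intros l0 m0 hs.
pose proof (service_rate_pos lambda mu s l0 m0 ltac:(lra)) as a0.
assert (d0 : 0 < mu * (1 - s)) by (apply Rmult_lt_0_compat; lra).
rewrite tau_of_sigma_log_ratio; unfold sigma_equation, log_ratio.
set (a := lambda + mu * (1 - s)) in *.
assert (sa : 0 < s * a) by (apply Rmult_lt_0_compat; lra).
split.
- intros e.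
  assert (E : exp (- mu * (1 - s) * t) = / (lambda / (s * a))).
  { replace (exp (- mu * (1 - s) * t))
      with (lambda * exp (- mu * (1 - s) * t) / a * a / lambda) by (field; lra).
    rewrite <- e; field; lra. }
  apply (f_equal ln) in E.
  rewrite ln_exp, ln_Rinv in E by (apply Rdiv_lt_0_compat; lra).
  replace (ln (lambda / (s * a))) with (mu * (1 - s) * t) by lra.
  field; lra.
- intros ->.
  replace (- mu * (1 - s) * _) with (- ln (lambda / (s * a))) by (field; lra).
  rewrite exp_Ropp, exp_ln by (apply Rdiv_lt_0_compat; lra).
  field; lra.
Qed.

(** Intermediate value theorem on [[0, rho]] for the equation with its denominator cleared: the
    difference of the sides is negative at 0, and at [rho] it is [lambda] times [1 - exp] of a
    nonpositive number. *)
Lemma sigma_equation_solvable (lambda mu t : R) :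
  0 < lambda -> 0 < mu -> lambda / mu < 1 -> 0 <= t ->
  exists s, 0 < s <= lambda / mu /\ sigma_equation lambda mu t s.
Proof.
intros l0 m0 hr t0; set (rho := lambda / mu).
assert (lr : lambda = mu * rho) by (unfold rho; field; lra).
assert (r0 : 0 < rho) by (apply Rdiv_lt_0_compat; lra).
set (f := fun s => s * (lambda + mu * (1 - s)) - lambda * exp (- mu * (1 - s) * t)).
assert (cf : continuity f).
{ intros x; apply continuity_pt_filterlim.
  apply (ex_derive_continuous f); unfold f; auto_derive; exact I. }
assert (f0 : f 0 < 0).
{ unfold f; pose proof (Rmult_lt_0_compat _ _ l0 (exp_pos (- mu * (1 - 0) * t))); lra. }
assert (fr : 0 <= f rho).
{ unfold f.
  replace (rho * (lambda + mu * (1 - rho))) with lambda by (rewrite lr; ring).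
  assert (E : exp (- mu * (1 - rho) * t) <= 1).
  { assert (0 <= mu * (1 - rho) * t)
      by (apply Rmult_le_pos; [apply Rmult_le_pos; unfold rho; lra | lra]).
    apply Rnot_lt_le; rewrite <- exp_0 at 1; intros lt.
    apply exp_lt_inv in lt; lra. }
  pose proof (Rmult_le_compat_l lambda _ _ (Rlt_le _ _ l0) E); lra. }
destruct (IVT_cor f 0 rho cf (Rlt_le _ _ r0)) as [s [[s0 sr] fs]].
{ pose proof (Rmult_le_compat_neg_l (f 0) 0 (f rho) ltac:(lra) fr); lra. }
exists s; split.
- split; [| exact sr].
  destruct s0 as [s0 | <-]; [exact s0 | lra].
- pose proof (service_rate_pos lambda mu s l0 m0 ltac:(unfold rho in *; lra)).
  unfold f in fs; unfold sigma_equation.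
  replace (lambda * _) with (s * (lambda + mu * (1 - s))) by lra.
  field; lra.
Qed.

(** A root [s'] below [s] would lie in [(0, 1)] and give the same [tau], against strict
    monotonicity. So [s] is a smallest root, and the one chosen by [epsilon] equals it. *)
Lemma sigma_tau_of_sigma (lambda mu s : R) :
  0 < lambda -> 0 < mu -> 0 < s < 1 ->
  Defs.sigma lambda mu (tau_of_sigma lambda mu s) = s.
Proof.
intros l0 m0 hs; set (t := tau_of_sigma lambda mu s).
assert (sol : smallest_positive_solution lambda mu t s).
{ split; [lra | split].
  - now apply sigma_equation_iff.
  - intros s' s'0 e; destruct (Rle_lt_dec s s') as [| lt]; [assumption |].
    apply sigma_equation_iff in e; [| assumption | assumption | lra].
    pose proof (tau_of_sigma_decreasing lambda mu s' s l0 m0 s'0 lt (proj2 hs)).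
    unfold t in e; lra. }
destruct (epsilon_spec (inhabits 0) (smallest_positive_solution lambda mu t)
  (ex_intro _ s sol)) as [p [e m]].
fold (Defs.sigma lambda mu t) in p, e, m.
destruct sol as [p' [e' m']].
apply Rle_antisym; auto.
Qed.

Lemma tau_of_sigma_rho (lambda mu : R) :
  0 < lambda -> 0 < mu -> lambda / mu < 1 ->
  tau_of_sigma lambda mu (lambda / mu) = 0.
Proof.
intros l0 m0 hr; rewrite tau_of_sigma_log_ratio; unfold log_ratio.
replace (lambda / (lambda / mu * _)) with 1 by (field; lra).
rewrite ln_1; apply Rdiv_0_l.
Qed.

Lemma tau_of_sigma_nonneg (lambda mu s : R) :
  0 < lambda -> 0 < mu -> lambda / mu < 1 -> 0 < s <= lambda / mu ->
  0 <= tau_of_sigma lambda mu s.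
Proof.
intros l0 m0 hr [s0 [lt | ->]].
- rewrite <- (tau_of_sigma_rho lambda mu) by assumption.
  left; apply tau_of_sigma_decreasing; lra.
- rewrite tau_of_sigma_rho by assumption; lra.
Qed.

(** * Positivity of [zeta] and the welfare as a function of the root *)

Lemma zeta_tau_of_sigma (lambda mu s : R) :
  0 < mu -> s < 1 ->
  zeta lambda mu s = mu * (1 - s) * (1 + lambda * tau_of_sigma lambda mu s).
Proof. intros; unfold zeta, tau_of_sigma; field; lra. Qed.

Lemma zeta_pos (lambda mu s : R) :
  0 < lambda -> 0 < mu -> lambda / mu < 1 -> 0 < s <= lambda / mu ->
  0 < zeta lambda mu s.
Proof.
intros l0 m0 hr hs; rewrite zeta_tau_of_sigma by lra.
pose proof (tau_of_sigma_nonneg lambda mu s l0 m0 hr hs).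
assert (0 <= lambda * tau_of_sigma lambda mu s) by (apply Rmult_le_pos; lra).
repeat apply Rmult_lt_0_compat; lra.
Qed.

Lemma welfare_tau_of_sigma (lambda mu reward cost s : R) :
  0 < lambda -> 0 < mu -> lambda / mu < 1 -> 0 < s <= lambda / mu ->
  welfare lambda mu reward cost (tau_of_sigma lambda mu s) =
  lambda * (mu * (1 - s) * reward - cost) / zeta lambda mu s.
Proof.
intros l0 m0 hr hs; unfold welfare.
rewrite sigma_tau_of_sigma, zeta_tau_of_sigma by lra.
pose proof (tau_of_sigma_nonneg lambda mu s l0 m0 hr hs).
assert (0 <= lambda * tau_of_sigma lambda mu s) by (apply Rmult_le_pos; lra).
field; lra.
Qed.

(** * Derivative, convexity and monotonicity of [zeta] *)

Definition zeta_deriv (lambda mu s : R) : R :=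
  - mu - lambda * (lambda + mu - 2 * mu * s) / (s * (lambda + mu * (1 - s))).

Lemma zeta_deriv_log_ratio_deriv (lambda mu s : R) :
  0 < lambda -> 0 < mu -> 0 < s <= 1 ->
  zeta_deriv lambda mu s = lambda * log_ratio_deriv lambda mu s - mu.
Proof.
intros l0 m0 [s0 s1]; pose proof (service_rate_pos lambda mu s l0 m0 s1).
unfold zeta_deriv, log_ratio_deriv; field; lra.
Qed.

Lemma is_derive_zeta (lambda mu s : R) :
  0 < lambda -> 0 < mu -> 0 < s <= 1 ->
  is_derive (zeta lambda mu) s (zeta_deriv lambda mu s).
Proof.
intros l0 m0 [s0 s1]; pose proof (service_rate_pos lambda mu s l0 m0 s1) as a0.
pose proof (Rmult_lt_0_compat _ _ s0 a0).
unfold zeta, zeta_deriv; auto_derive.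
- repeat split; try lra.
  apply Rdiv_lt_0_compat; lra.
- field; lra.
Qed.

Lemma zeta_above_tangent (lambda mu s x : R) :
  0 < lambda -> 0 < mu -> 0 < s <= 1 -> 0 < x <= 1 -> x <> s ->
  zeta lambda mu s + zeta_deriv lambda mu s * (x - s) < zeta lambda mu x.
Proof.
intros l0 m0 hs hx ne; rewrite zeta_deriv_log_ratio_deriv by assumption.
pose proof (Rmult_lt_compat_l lambda _ _ l0
  (log_ratio_above_tangent lambda mu s x l0 m0 hs hx ne)) as T.
unfold zeta; fold (log_ratio lambda mu s) (log_ratio lambda mu x); lra.
Qed.

(** Adding the tangent inequalities taken at each point and evaluated at the other cancels the
    values of [zeta]. *)
Lemma zeta_deriv_increasing (lambda mu s1 s2 : R) :
  0 < lambda -> 0 < mu -> 0 < s1 -> s1 < s2 -> s2 <= 1 ->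
  zeta_deriv lambda mu s1 < zeta_deriv lambda mu s2.
Proof.
intros l0 m0 h1 h12 h2.
pose proof (zeta_above_tangent lambda mu s1 s2 l0 m0
  ltac:(lra) ltac:(lra) ltac:(lra)).
pose proof (zeta_above_tangent lambda mu s2 s1 l0 m0
  ltac:(lra) ltac:(lra) ltac:(lra)).
apply (Rmult_lt_reg_r (s2 - s1)); lra.
Qed.

Lemma zeta_deriv_neg (lambda mu s : R) :
  0 < lambda -> 0 < mu -> lambda / mu < 1 -> 0 < s <= lambda / mu ->
  zeta_deriv lambda mu s < 0.
Proof.
intros l0 m0 hr hs.
pose proof (service_rate_pos lambda mu s l0 m0 ltac:(lra)).
(* Together with [lambda < mu] this makes [lambda + mu - 2 * mu * s] positive. *)
assert (ms : mu * s <= lambda).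
{ replace lambda with (mu * (lambda / mu)) by (field; lra).
  apply Rmult_le_compat_l; lra. }
assert (lm : lambda < mu).
{ replace lambda with (mu * (lambda / mu)) by (field; lra).
  pose proof (Rmult_lt_compat_l mu _ _ m0 hr); lra. }
unfold zeta_deriv.
assert (0 < lambda * (lambda + mu - 2 * mu * s) / (s * (lambda + mu * (1 - s)))).
{ apply Rdiv_lt_0_compat; apply Rmult_lt_0_compat; lra. }
lra.
Qed.

(** * Sign of [welfare_slope], the numerator [G] of the derivative of [N / zeta] *)

Definition welfare_slope (lambda mu reward cost s : R) : R :=
  - mu * reward * zeta lambda mu s
  - (mu * (1 - s) * reward - cost) * zeta_deriv lambda mu s.

Lemma welfare_slope_single_crossing (lambda mu reward cost s1 s2 : R) :
  0 < lambda -> 0 < mu -> 0 < reward -> lambda / mu < 1 ->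
  0 < s1 -> s1 < s2 -> s2 <= lambda / mu ->
  0 <= welfare_slope lambda mu reward cost s2 ->
  0 < welfare_slope lambda mu reward cost s1.
Proof.
unfold welfare_slope; intros l0 m0 r0 hr h1 h12 h2 H.
pose proof (zeta_pos lambda mu s2 l0 m0 hr ltac:(lra)) as z0.
pose proof (zeta_deriv_neg lambda mu s2 l0 m0 hr ltac:(lra)) as d0.
pose proof (Rmult_lt_0_compat _ _ m0 r0) as mr.
pose proof (zeta_above_tangent lambda mu s1 s2 l0 m0
  ltac:(lra) ltac:(lra) ltac:(lra)) as T.
pose proof (zeta_deriv_increasing lambda mu s1 s2 l0 m0 h1 h12 ltac:(lra)) as I.
(* If [N(s2) <= 0], then [zeta > 0] and [zeta' < 0] would make [G(s2)] negative. *)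
assert (N0 : 0 < mu * (1 - s2) * reward - cost).
{ destruct (Rlt_le_dec 0 (mu * (1 - s2) * reward - cost)) as [| le]; [assumption |].
  pose proof (Rmult_lt_0_compat _ _ mr z0).
  assert (0 <= - (mu * (1 - s2) * reward - cost) * - zeta_deriv lambda mu s2)
    by (apply Rmult_le_pos; lra).
  lra. }
(* Since [N(s1) = N(s2) + mu R (s2 - s1)], the two scaled inequalities add up to [G(s2) < G(s1)]. *)
apply (Rmult_lt_compat_l _ _ _ mr) in T.
apply (Rmult_lt_compat_l _ _ _ N0) in I.
lra.
Qed.

Lemma welfare_slope_rho (lambda mu reward cost : R) :
  0 < lambda -> 0 < mu -> lambda / mu < 1 ->
  welfare_slope lambda mu reward cost (lambda / mu) =
  reward * (mu - lambda) ^ 2 - cost * (2 * mu - lambda).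
Proof.
intros l0 m0 hr; unfold welfare_slope.
rewrite zeta_tau_of_sigma, tau_of_sigma_rho by assumption.
unfold zeta_deriv; field; lra.
Qed.

Lemma welfare_slope_rho_nonneg_iff (lambda mu reward cost : R) :
  0 < lambda -> 0 < mu -> 0 < cost -> lambda / mu < 1 ->
  0 <= welfare_slope lambda mu reward cost (lambda / mu) <->
  mu * reward / cost >= (2 - lambda / mu) / (1 - lambda / mu) ^ 2.
Proof.
intros l0 m0 c0 hr.
assert (lm : 0 < mu - lambda).
{ replace (mu - lambda) with (mu * (1 - lambda / mu)) by (field; lra).
  apply Rmult_lt_0_compat; lra. }
(* The positive factor between [G(rho)] and the gap in the threshold inequality. *)
set (k := cost * (mu - lambda) ^ 2 / mu).
assert (k0 : 0 < k).
{ apply Rdiv_lt_0_compat; [apply Rmult_lt_0_compat; [| apply pow_lt]; lra | lra]. }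
assert (E : welfare_slope lambda mu reward cost (lambda / mu) =
  k * (mu * reward / cost - (2 - lambda / mu) / (1 - lambda / mu) ^ 2)).
{ rewrite welfare_slope_rho by assumption; unfold k; field; lra. }
rewrite E; split; intros H.
- apply Rle_ge, Rminus_le_0, (Rmult_le_reg_l k); lra.
- apply Rmult_le_pos; lra.
Qed.

(* The difference [N(x) zeta(s) - N(s) zeta(x)] is nonpositive in [x], vanishes
   at [x = s], and has derivative [welfare_slope] there. *)
Lemma welfare_slope_at_maximizer (lambda mu reward cost s x : R) :
  0 < lambda -> 0 < mu -> lambda / mu < 1 ->
  is_maximizer_nonneg (welfare lambda mu reward cost) (tau_of_sigma lambda mu s) ->
  0 < s <= lambda / mu -> 0 < x <= lambda / mu ->
  welfare_slope lambda mu reward cost s * (x - s) <= 0.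
Proof.
intros l0 m0 hr [_ hmax] hs hx.
apply Rnot_lt_le; intros pos.
set (F := fun y => (mu * (1 - y) * reward - cost) * zeta lambda mu s
                   - (mu * (1 - s) * reward - cost) * zeta lambda mu y).
assert (D : is_derive F s (welfare_slope lambda mu reward cost s)).
{ pose proof (is_derive_zeta lambda mu s l0 m0 ltac:(lra)) as dz.
  unfold F; auto_derive.
  - now exists (zeta_deriv lambda mu s).
  - change (Derive _ s) with (Derive (zeta lambda mu) s).
    rewrite (is_derive_unique _ _ _ dz).
    unfold welfare_slope; ring. }
destruct (is_derive_pos_direction F s _ _ D pos) as [t [ht Ft]].
set (y := s + t * (x - s)) in Ft.
assert (hy : 0 < y <= lambda / mu).
{ replace y with (t * x + (1 - t) * s) by (unfold y; ring).
  assert (0 < t * x) by (apply Rmult_lt_0_compat; lra).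
  assert (0 < (1 - t) * s) by (apply Rmult_lt_0_compat; lra).
  assert (t * x <= t * (lambda / mu)) by (apply Rmult_le_compat_l; lra).
  assert ((1 - t) * s <= (1 - t) * (lambda / mu)) by (apply Rmult_le_compat_l; lra).
  lra. }
pose proof (hmax _ (tau_of_sigma_nonneg lambda mu y l0 m0 hr hy)) as W.
rewrite !welfare_tau_of_sigma in W by assumption.
pose proof (zeta_pos lambda mu s l0 m0 hr hs) as zs.
pose proof (zeta_pos lambda mu y l0 m0 hr hy) as zy.
apply Rminus_le_0 in W.
(* Clearing denominators turns the welfare comparison into [F y <= F s], against [Ft]. *)
apply (Rmult_le_compat_r (zeta lambda mu s * zeta lambda mu y / lambda)) in W.
2: { left; apply Rdiv_lt_0_compat; [apply Rmult_lt_0_compat |]; lra. }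
assert (E : F s - F y =
  (lambda * (mu * (1 - s) * reward - cost) / zeta lambda mu s
   - lambda * (mu * (1 - y) * reward - cost) / zeta lambda mu y)
  * (zeta lambda mu s * zeta lambda mu y / lambda)) by (unfold F; field; lra).
lra.
Qed.

Theorem mainTheorem3 (lambda mu reward cost taustar : R)
  (hlambda : 0 < lambda) (hmu : 0 < mu) (hreward : 0 < reward)
  (hcost : 0 < cost)
  (hrho : lambda / mu < 1)
  (hprofit : mu * reward > cost)
  (hmax : is_maximizer_nonneg (welfare lambda mu reward cost) taustar) :
  let rho := lambda / mu in
  (taustar = 0 <-> mu * reward / cost >= (2 - rho) / (1 - rho) ^ 2) /\
  (forall s : R, 0 < s < rho ->
     is_derive (zeta lambda mu) s
       (- mu - lambda * (lambda + mu - 2 * mu * s)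
               / (s * (lambda + mu * (1 - s))))) /\
  (mu * reward / cost < (2 - rho) / (1 - rho) ^ 2 ->
   exists sigmastar : R,
     unique (fun s : R => 0 < s < rho /\
               mu * reward * zeta lambda mu s =
               - (mu * (1 - s) * reward - cost) * Derive (zeta lambda mu) s)
            sigmastar /\
     taustar = tau_of_sigma lambda mu sigmastar /\
     welfare lambda mu reward cost taustar =
       lambda * (mu * (1 - sigmastar) * reward - cost)
       / zeta lambda mu sigmastar).
Proof.
intros rho.
assert (r0 : 0 < rho) by (apply Rdiv_lt_0_compat; lra).
(* Any root in [(0, rho]] for [taustar] represents it as [tau(s)]. *)
destruct (sigma_equation_solvable lambda mu taustar hlambda hmu hrho (proj1 hmax))
  as [s [hs eqs]].
fold rho in hs, hrho.
apply sigma_equation_iff in eqs; [| assumption | assumption | lra].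
subst taustar.
pose proof (fun x => welfare_slope_at_maximizer lambda mu reward cost s x
  hlambda hmu hrho hmax hs) as opt; fold rho in opt.
pose proof (welfare_slope_rho_nonneg_iff lambda mu reward cost
  hlambda hmu hcost hrho) as iff_rho; fold rho in iff_rho.
pose proof (fun s1 s2 => welfare_slope_single_crossing lambda mu reward cost s1 s2
  hlambda hmu hreward hrho) as crossing; fold rho in crossing.
(* At an interior maximizer the test points [rho] and [s / 2], one on each side, bound [G(s)] from
   above and below. *)
assert (stationary : s < rho -> welfare_slope lambda mu reward cost s = 0).
{ intros lt.
  assert (A := opt rho ltac:(lra)); assert (B := opt (s / 2) ltac:(lra)).
  apply Rle_antisym.
  - apply (Rmult_le_reg_r (rho - s)); lra.
  - apply (Rmult_le_reg_r (s / 2)); lra. }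
(* At the end point only the left direction is available, giving [G(rho) >= 0]. Conversely,
   [G(rho) >= 0] would force [G(s) > 0] at any [s < rho], against stationarity. *)
assert (at_rho : s = rho <-> 0 <= welfare_slope lambda mu reward cost rho).
{ split.
  - intros e; assert (B := opt (s / 2) ltac:(lra)); rewrite e in B.
    apply (Rmult_le_reg_r (rho / 2)); lra.
  - intros H; destruct hs as [s0 [lt |]]; [| assumption].
    pose proof (crossing s rho s0 lt (Rle_refl _) H); specialize (stationary lt); lra. }
split; [| split].
- rewrite <- iff_rho, <- at_rho; split.
  + intros e; destruct hs as [s0 [lt |]]; [| assumption].
    pose proof (tau_of_sigma_decreasing lambda mu s rho hlambda hmu s0 lt hrho) as d.
    unfold rho in d; rewrite tau_of_sigma_rho in d by assumption; lra.
  + intros ->; now apply tau_of_sigma_rho.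
- intros x hx; apply is_derive_zeta; lra.
- intros small.
  assert (lt : s < rho).
  { destruct hs as [_ [| e]]; [assumption |]; apply at_rho, iff_rho in e; lra. }
  assert (root_iff : forall x, 0 < x < rho ->
    mu * reward * zeta lambda mu x =
      - (mu * (1 - x) * reward - cost) * Derive (zeta lambda mu) x <->
    welfare_slope lambda mu reward cost x = 0).
  { intros x hx.
    rewrite (is_derive_unique _ _ _
      (is_derive_zeta lambda mu x hlambda hmu ltac:(lra))).
    unfold welfare_slope; split; lra. }
  (* The maximizer's own root serves as [sigmastar], so existence comes from stationarity. *)
  exists s; repeat split.
  + lra.
  + lra.
  + apply root_iff; [lra | auto].
  + intros x [hx ex]; apply root_iff in ex; [| assumption].
    specialize (stationary lt).
    (* Of two distinct zeros of [G], single crossing would make [G] positive at the left one. *)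
    destruct (Rtotal_order s x) as [h | [h | h]]; [| assumption |].
    * pose proof (crossing s x ltac:(lra) h ltac:(lra) ltac:(lra)); lra.
    * pose proof (crossing x s ltac:(lra) h ltac:(lra) ltac:(lra)); lra.
  + now apply welfare_tau_of_sigma.
Qed.
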